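(* Let $k$ be a positive integer and consider the $k$-th order system of two rational difference equations $$x_n=\frac{\alpha+\sum^{k}_{i=1}\beta_{i}x_{n-i} + \sum^{k}_{i=1}\gamma_{i}y_{n-i}}{A+\sum^{k}_{j=1}B_{j}x_{n-j} + \sum^{k}_{j=1}C_{j}y_{n-j}},\qquad y_n=\frac{p+\sum^{k}_{i=1}\delta_{i}x_{n-i} + \sum^{k}_{i=1}\epsilon_{i}y_{n-i}}{q+\sum^{k}_{j=1}D_{j}x_{n-j} + \sum^{k}_{j=1}E_{j}y_{n-j}},\qquad n\in\mathbb{N},$$ with non-negative real parameters and non-negative initial conditions. Suppose that $A=0$ and that at least one of the following holds: (i) $I_B\subseteq I_\beta$, $I_C\subseteq I_\gamma$, and $I_B\neq\emptyset$; (ii) $q=0$, $I_D\subseteq I_\delta$, $I_E\subseteq I_\epsilon$, and $I_C\neq\emptyset$; (iii) $p>0$, $q>0$, $I_D\subseteq I_\delta$, $I_E\subseteq I_\epsilon$, and $I_C\neq\emptyset$. Suppose moreover that $I_\gamma\subseteq I_C$ and that there exists a positive integer $\eta$ such that for every sequence $\{c_m\}_{m=1}^\infty$ with $c_m\in I_\beta$ for all $m\ge 1$ there exist positive integers $N_1,N_2\le\eta$ such that $\sum_{m=N_1}^{N_2}c_m\in I_B$. Then there exist $M>0$ and $N\in\mathbb{N}$ such that every solution (from any non-negative initial conditions) satisfies $x_n\le M$ for all $n>N$.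
   Context: $\mathbb{N}=\{1,2,\dots\}$. Initial conditions are $x_{1-k},\dots,x_0,y_{1-k},\dots,y_0\ge 0$; a solution is a pair of sequences generated by the system from non-negative initial conditions for which all denominators are positive for every $n\in\mathbb{N}$. For each family of coefficients, the index set is the set of indices in $\{1,\dots,k\}$ with positive coefficient: $I_\beta=\{i:\beta_i>0\}$, $I_\gamma=\{i:\gamma_i>0\}$, $I_\delta=\{i:\delta_i>0\}$, $I_\epsilon=\{i:\epsilon_i>0\}$, $I_B=\{j:B_j>0\}$, $I_C=\{j:C_j>0\}$, $I_D=\{j:D_j>0\}$, $I_E=\{j:E_j>0\}$. A sum $\sum_{m=N_1}^{N_2}$ with $N_1>N_2$ is empty and equals $0$. *)

(* Defs.v *)
From mathcomp Require Import all_boot all_order all_algebra.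
From mathcomp Require Import reals.

Set Implicit Arguments.
Unset Strict Implicit.
Unset Printing Implicit Defensive.

Import Order.TTheory GRing.Theory Num.Theory.
Local Open Scope ring_scope.

(* Coefficient families are functions on nat of which only the values at
   1, ..., k are used.  Sequences are indexed by int so that the initial
   conditions keep their indices 1-k, ..., 0; values below 1-k are never
   read. *)

Definition nonneg_coefs (R : realType) (k : nat) (b : nat -> R) : Prop :=
  forall i : nat, (1 <= i <= k)%N -> 0 <= b i.

Definition index_set (R : realType) (k : nat) (b : nat -> R) : pred nat :=
  [pred i : nat | (1 <= i <= k)%N && (0 < b i)].

Definition affine_form (R : realType) (k : nat)
    (a : R) (b c : nat -> R) (x y : int -> R) (n : int) : R :=
  a + \sum_(1 <= i < k.+1) b i * x (n - i%:Z)
    + \sum_(1 <= i < k.+1) c i * y (n - i%:Z).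

Definition nonneg_initial (R : realType) (k : nat) (x : int -> R) : Prop :=
  forall m : int, 1 - k%:Z <= m <= 0 -> 0 <= x m.

Definition is_solution (R : realType) (k : nat)
    (alpha : R) (beta gamma : nat -> R) (A : R) (B C : nat -> R)
    (p : R) (delta epsilon : nat -> R) (q : R) (D E : nat -> R)
    (x y : int -> R) : Prop :=
  [/\ nonneg_initial k x,
      nonneg_initial k y &
      forall n : nat, (1 <= n)%N ->
        [/\ 0 < affine_form k A B C x y n%:Z,
            0 < affine_form k q D E x y n%:Z,
            x n%:Z = affine_form k alpha beta gamma x y n%:Z
                     / affine_form k A B C x y n%:Z &
            y n%:Z = affine_form k p delta epsilon x y n%:Z
                     / affine_form k q D E x y n%:Z]].

(* Main.v *)
(* Domination of the denominators by the numerators bounds x_n (or y_n) away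
   from 0, hence bounds the denominator Den_n of x_n below by some d > 0.  Since
   I_gamma is contained in I_C, for large n
     x_n <= K + L * x_(n-i) / Den_n,
   where i in I_beta maximizes x_(n-i).  Following these maximizing lags from n
   gives one sequence c_1, c_2, ... in I_beta and the indices
   n_m = n - c_1 - ... - c_m.  If c_N1 + ... + c_N2 = j is in I_B, the
   denominator met at n_(N1-1) is at least B_j x_(n_N2), which cancels the
   factor x_(n_N2) left after N2 steps; every other denominator is at least d. *)

Require Import Defs.
From mathcomp Require Import all_boot all_order all_algebra.
From mathcomp Require Import reals.
From mathcomp Require Import zify lra.

Set Implicit Arguments.
Unset Strict Implicit.
Unset Printing Implicit Defensive.

Import Order.TTheory GRing.Theory Num.Theory.
Local Open Scope ring_scope.

(** * Comparison of finite sums with non-negative weights *)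

Section WeightedSums.
Variables (R : realType) (k : nat).
Implicit Types (b u : nat -> R).

Local Notation wsum b u := (\sum_(1 <= i < k.+1) b i * u i).

Lemma wsum_ge0 b u :
  nonneg_coefs k b -> nonneg_coefs k u -> 0 <= wsum b u.
Proof.
move=> b0 u0; rewrite big_nat; apply: sumr_ge0 => i ik.
by rewrite mulr_ge0 ?b0 ?u0.
Qed.

Lemma wsum_ge_term b u i : nonneg_coefs k b -> nonneg_coefs k u ->
  (1 <= i <= k)%N -> b i * u i <= wsum b u.
Proof.
move=> b0 u0 ik; rewrite (bigD1_seq i) ?mem_index_iota ?iota_uniq //=.
rewrite lerDl big_seq_cond; apply: sumr_ge0 => j /andP[].
by rewrite mem_index_iota => jk _; rewrite mulr_ge0 ?b0 ?u0.
Qed.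

Lemma notin_index_set b i : nonneg_coefs k b -> (1 <= i <= k)%N ->
  i \notin index_set k b -> b i = 0.
Proof.
by move=> b0 ik; rewrite inE ik /= -leNgt => bi; apply/le_anti; rewrite bi b0.
Qed.

(** Each term [b' i * u i] is the ratio [b' i / b i] times a single term of the sum for [b], so the
    sum of the ratios serves for every [u]. Where [b i] is 0, so is [b' i], and the ratio is 0. *)
Lemma wsum_dominated b b' : nonneg_coefs k b -> nonneg_coefs k b' ->
  {subset index_set k b' <= index_set k b} ->
  exists2 S : R, 0 <= S &
    forall u, nonneg_coefs k u -> wsum b' u <= S * wsum b u.
Proof.
move=> b0 b'0 sub; exists (\sum_(1 <= i < k.+1) b' i / b i).
  rewrite big_nat; apply: sumr_ge0 => i ik.
  by rewrite divr_ge0 ?b0 ?b'0.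
move=> u u0; rewrite mulr_suml big_nat [leRHS]big_nat; apply: ler_sum => i ik.
have [bi|bi] := boolP (i \in index_set k b'); last first.
  by rewrite (notin_index_set b'0 ik bi) !mul0r.
have /andP[_ bp] := sub _ bi.
rewrite -[b' i * _](_ : b' i / b i * (b i * u i) = _).
  apply: ler_wpM2l; first by rewrite divr_ge0 ?b0 ?b'0.
  exact: wsum_ge_term.
by rewrite mulrA divfK ?gt_eqF.
Qed.

(** The index maximizes [u] over the index set, which [i0] shows to be non-empty; all other terms
    vanish. *)
Lemma wsum_le_argmax b : nonneg_coefs k b ->
  forall i0, i0 \in index_set k b -> forall u,
  exists i, (i \in index_set k b) &&
    (wsum b u <= (\sum_(1 <= i < k.+1) b i) * u i).
Proof.
move=> b0 i0 i0b u.
have i0k : (i0 < k.+1)%N by move: i0b; rewrite inE => /andP[/andP[]].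
pose P := [pred i : 'I_k.+1 | val i \in index_set k b].
case: (@arg_maxP _ _ _ (Ordinal i0k) P (fun i => u (val i)) i0b) => i Pi imax.
exists (val i); apply/andP; split=> //.
rewrite mulr_suml big_nat [leRHS]big_nat; apply: ler_sum => j jk.
have [bj|bj] := boolP (j \in index_set k b); last first.
  by rewrite (notin_index_set b0 jk bj) !mul0r.
apply: ler_wpM2l; first exact: b0.
have jk1 : (j < k.+1)%N by case/andP: jk.
exact: (imax (Ordinal jk1)).
Qed.

End WeightedSums.

(** * Bounds for numerators and denominators *)

Section AffineForms.
Variables (R : realType) (k : nat).
Implicit Types (a : R) (b c : nat -> R) (x y : int -> R).

(** The values read by a form at [n], seen as a family indexed by the lag, so that the lemmas on
    weighted sums apply. *)
Definition nonneg_window x (n : int) : Prop :=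
  nonneg_coefs k (fun i => x (n - i%:Z)).

Lemma affine_form_ge0 a b c x y n :
  0 <= a -> nonneg_coefs k b -> nonneg_coefs k c ->
  nonneg_window x n -> nonneg_window y n -> 0 <= affine_form k a b c x y n.
Proof.
move=> a0 b0 c0 x0 y0; rewrite !addr_ge0 //.
  exact: wsum_ge0 b0 x0.
exact: wsum_ge0 c0 y0.
Qed.

Lemma affine_form_ge_left a b c x y n i :
  0 <= a -> nonneg_coefs k b -> nonneg_coefs k c ->
  nonneg_window x n -> nonneg_window y n -> (1 <= i <= k)%N ->
  b i * x (n - i%:Z) <= affine_form k a b c x y n.
Proof.
move=> a0 b0 c0 x0 y0 ik.
have := wsum_ge_term b0 x0 ik; have := wsum_ge0 c0 y0.
rewrite /affine_form; lra.
Qed.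

Lemma affine_form_ge_right a b c x y n i :
  0 <= a -> nonneg_coefs k b -> nonneg_coefs k c ->
  nonneg_window x n -> nonneg_window y n -> (1 <= i <= k)%N ->
  c i * y (n - i%:Z) <= affine_form k a b c x y n.
Proof.
move=> a0 b0 c0 x0 y0 ik.
have := wsum_ge_term c0 y0 ik; have := wsum_ge0 b0 x0.
rewrite /affine_form; lra.
Qed.

Lemma affine_form_dominated a b c a' b' c' :
  0 <= a -> nonneg_coefs k b -> nonneg_coefs k c ->
  0 <= a' -> nonneg_coefs k b' -> nonneg_coefs k c' ->
  a' = 0 \/ 0 < a ->
  {subset index_set k b' <= index_set k b} ->
  {subset index_set k c' <= index_set k c} ->
  exists2 S : R, 0 < S &
    forall x y n, nonneg_window x n -> nonneg_window y n ->
      affine_form k a' b' c' x y n <= S * affine_form k a b c x y n.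
Proof.
move=> a0 b0 c0 a'0 b'0 c'0 aa' sb sc.
have [S1 S1_ge0 hS1] := wsum_dominated b0 b'0 sb.
have [S2 S2_ge0 hS2] := wsum_dominated c0 c'0 sc.
have [S3 S3_ge0 hS3] : exists2 S3 : R, 0 <= S3 & a' <= S3 * a.
  case: aa' => [->|ap]; first by exists 0; rewrite ?mul0r.
  by exists (a' / a); rewrite ?divr_ge0 // divfK // gt_eqF.
(* The summand 1 makes the constant positive, so that its inverse can be a positive lower bound for
   a quotient. *)
exists (1 + S1 + S2 + S3) => [|x y n x0 y0]; first lra.
have := hS1 _ x0; have := hS2 _ y0.
have := wsum_ge0 b0 x0; have := wsum_ge0 c0 y0.
rewrite /affine_form; move: (\sum_(_ <= _ < _) _) => Y.
move: (\sum_(_ <= _ < _) _) => X; nra.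
Qed.

End AffineForms.

(** * Boundedness along a chain of lags, for abstract [u] (the solution) and [w] (its
    denominator) *)

Section ChainBound.
Variables (R : realType) (k eta : nat) (I J : pred nat).
Variables (u w : nat -> R) (K L d S : R).

(** One step costs at most a factor [L / d]; the added 1 gives [T >= 1], so powers of [T] grow with
    the exponent and [U + W * v] bounds any run of at most [eta] steps ending at the value [v]. *)
Let T := 1 + L / d.
Let U := K * eta%:R * T ^+ eta.
Let W := T ^+ eta.

(** Read from the outside: a run up to the special denominator, the step through it, then a run
    whose end value is cancelled by that denominator up to [S]. *)
Definition chain_bound : R := U + W * (K + L * (U / d + W * S)).

Hypothesis K_ge0 : 0 <= K.
Hypothesis L_ge0 : 0 <= L.
Hypothesis d_gt0 : 0 < d.
Hypothesis I_le_k : forall i, i \in I -> (i <= k)%N.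
Hypothesis J_gt0 : forall j, j \in J -> (0 < j)%N.
Hypothesis u_ge0 : forall n, 0 <= u n.
Hypothesis w_ge : forall n, (k < n)%N -> d <= w n.
Hypothesis w_J : forall n j, (k < n)%N -> j \in J -> (j <= n)%N ->
  u (n - j)%N <= S * w n.
Hypothesis step : forall n, exists i, (i \in I) &&
  ((k < n)%N ==> (u n <= K + L * (u (n - i)%N / w n))).
Hypothesis chain : forall c : nat -> nat,
  (forall m : nat, (1 <= m)%N -> c m \in I) ->
  exists N1 N2 : nat,
    [/\ (1 <= N1 <= eta)%N, (1 <= N2 <= eta)%N &
        (\sum_(N1 <= m < N2.+1) c m)%N \in J].

(** Lags are at most [k], so the threshold keeps positions 0 to [eta] of the chain above [k], where
    the step inequality and [d <= w] hold. *)
Lemma chain_bound_le n : (eta.+1 * k < n)%N -> u n <= chain_bound.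
Proof.
move=> n_gt.
(* The lag lies in [I] even for [v <= k], so the infinite sequence of lags is admissible in
   [chain]. *)
pose g v := xchoose (step v).
have gI v : g v \in I by case/andP: (xchooseP (step v)).
have gk v : (g v <= k)%N by exact/I_le_k/gI.
have gstep v : (k < v)%N -> u v <= K + L * (u (v - g v)%N / w v).
  by case/andP: (xchooseP (step v)) => _ /implyP.
have [pos pos0 posS] : exists2 pos : nat -> nat, pos 0%N = n &
    forall m, pos m.+1 = (pos m - g (pos m))%N.
  by exists (fun m => iter m (fun v => v - g v)%N n).
have pos_ge m : (n <= pos m + m * k)%N.
  elim: m => [|m IHm]; first by rewrite pos0; lia.
  by have := gk (pos m); rewrite posS; nia.
have pos_gt m : (m <= eta)%N -> (k < pos m)%N.
  by move=> m_le; have := pos_ge m; nia.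
have T_ge1 : 1 <= T by rewrite lerDl divr_ge0 // ltW.
have T_ge0 : 0 <= T by lra.
have step1 m : (m <= eta)%N -> u (pos m) <= K + T * u (pos m.+1).
  move=> /pos_gt m_gt; apply: (le_trans (gstep _ m_gt)); rewrite -posS lerD2l.
  have w_inv : (w (pos m))^-1 <= d^-1.
    by rewrite lef_pV2 ?posrE ?w_ge // (lt_le_trans d_gt0) ?w_ge.
  apply: (@le_trans _ _ (L * (u (pos m.+1) / d))).
    by apply: ler_wpM2l => //; apply: ler_wpM2l.
  by have := u_ge0 (pos m.+1); rewrite /T mulrDl mul1r mulrCA mulrA mulrC; lra.
(* The geometric sum [K * (1 + T + ... + T ^+ (r - 1))] is replaced by the cruder
   [K * r * T ^+ r]. *)
have stepr r m : (m + r <= eta.+1)%N ->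
    u (pos m) <= K * r%:R * T ^+ r + T ^+ r * u (pos (m + r)%N).
  elim: r m => [|r IHr] m mr.
    by rewrite addn0 expr0 mulr0 mul0r add0r mul1r.
  have := IHr m.+1; rewrite addSnnS => /(_ mr) hr.
  have hm : u (pos m) <= K + T * u (pos m.+1) by apply: step1; lia.
  apply: (le_trans hm); rewrite -natr1 exprS.
  have Tr : 1 <= T ^+ r.+1 by rewrite exprn_ege1.
  have := ler_wpM2l T_ge0 hr; have := ler_wpM2l K_ge0 Tr; rewrite exprS.
  by move=> hK hT; nra.
have W_ge0 : 0 <= W by exact: exprn_ge0.
have U_ge0 : 0 <= U by rewrite !mulr_ge0.
have jump m m' : (m <= m')%N -> (m' <= eta)%N ->
    u (pos m) <= U + W * u (pos m').
  move=> mm' m'_le; have r_le : (m' - m <= eta)%N by lia.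
  have hr : u (pos m) <= _ := @stepr (m' - m)%N m _; rewrite subnKC // in hr.
  apply: (le_trans (hr _)); first lia.
  have Tr : T ^+ (m' - m) <= W by rewrite ler_weXn2l.
  apply: lerD; last exact: ler_wpM2r.
  by rewrite ler_pM ?mulr_ge0 ?exprn_ge0 // ler_wpM2l // ler_nat.
(* The shift makes [c 1] the lag leaving [pos 0 = n]. *)
pose c m := g (pos m.-1).
have [N1 [N2 [/andP[N1_gt0 N1_le] /andP[_ N2_le]]]] :=
  @chain c (fun m _ => gI _).
set j := (\sum_(N1 <= m < N2.+1) c m)%N => jJ.
(* Otherwise the sum is empty, hence 0, which is not in [J]. *)
have N12 : (N1 <= N2)%N.
  by rewrite leqNgt; apply/negP => N21; have := J_gt0 jJ; rewrite /j big_geq.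
(* The lags telescope; no subtraction truncates, since the positions left exceed [k]. *)
have posj : pos N1.-1 = (pos N2 + j)%N.
  rewrite /j {jJ j}; elim: N2 N12 N2_le => [|m IHm] N12 m_le; first by lia.
  rewrite big_nat_recr //= {2}/c /=.
  have pos_m : pos m = (pos m.+1 + g (pos m))%N.
    by rewrite posS subnK //; have := gk (pos m); have := pos_gt m; lia.
  have [N1m|N1m] := eqVneq N1 m.+1.
    by rewrite N1m big_geq // -[RHS]pos_m.
  by rewrite IHm; lia.
have N1p_gt : (k < pos N1.-1)%N by apply: pos_gt; lia.
have w_gt0 : 0 < w (pos N1.-1) by exact/(lt_le_trans d_gt0)/w_ge.
have uN2 : u (pos N2) <= S * w (pos N1.-1).
  by have := w_J N1p_gt jJ; rewrite posj addnK; apply; lia.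
have uN1 := jump _ _ N12 N2_le.
have posN1 : (pos N1.-1 - g (pos N1.-1))%N = pos N1.
  by rewrite -posS prednK.
(* The denominator is used twice: as at least [d] against [U], and through [uN2] against
   [u (pos N2)]. *)
have ratio : u (pos N1) / w (pos N1.-1) <= U / d + W * S.
  rewrite ler_pdivrMr //; apply: (le_trans uN1); rewrite mulrDl.
  apply: lerD; last by rewrite -mulrA ler_wpM2l.
  by rewrite -mulrA ler_peMr // ler_pdivlMl // mulr1 w_ge.
rewrite -pos0; apply: (le_trans (jump 0%N N1.-1 _ _)) => //; first by lia.
rewrite lerD2l ler_wpM2l //; apply: (le_trans (gstep _ N1p_gt)).
by rewrite posN1 lerD2l ler_wpM2l.
Qed.

End ChainBound.

(** * Estimates for solutions, uniform in the initial conditions *)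

Section Solutions.
Variables (R : realType) (k : nat) (alpha A p q : R).
Variables (beta gamma B C delta epsilon D E : nat -> R).
Hypotheses (alpha_ge0 : 0 <= alpha) (A_ge0 : 0 <= A).
Hypotheses (p_ge0 : 0 <= p) (q_ge0 : 0 <= q).
Hypotheses (beta_ge0 : nonneg_coefs k beta) (gamma_ge0 : nonneg_coefs k gamma).
Hypotheses (B_ge0 : nonneg_coefs k B) (C_ge0 : nonneg_coefs k C).
Hypotheses (delta_ge0 : nonneg_coefs k delta).
Hypotheses (epsilon_ge0 : nonneg_coefs k epsilon).
Hypotheses (D_ge0 : nonneg_coefs k D) (E_ge0 : nonneg_coefs k E).

Local Notation solution :=
  (is_solution k alpha beta gamma A B C p delta epsilon q D E).
Local Notation den x y n := (affine_form k A B C x y n%:Z).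

Lemma solution_ge0 x y : solution x y ->
  forall m : int, 1 - k%:Z <= m -> 0 <= x m /\ 0 <= y m.
Proof.
case=> x0 y0 sol.
(* Strong induction over integer indices, run on a natural upper bound. *)
suff H (n : nat) (m : int) : 1 - k%:Z <= m <= n%:Z -> 0 <= x m /\ 0 <= y m.
  by move=> m m_ge; apply: (H `|m|%N); lia.
elim: n m => [|n IHn] m mk.
  by split; [apply: x0|apply: y0].
have [m_le|m_gt] := leP m n%:Z; first by apply: IHn; lia.
have -> : m = n.+1%:Z by lia.
have [//|/ltW dx0 /ltW dy0 -> ->] := sol n.+1.
have wx : nonneg_window k x n.+1%:Z by move=> i ik; apply: (IHn _ _).1; lia.
have wy : nonneg_window k y n.+1%:Z by move=> i ik; apply: (IHn _ _).2; lia.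
by split; apply: divr_ge0 => //; apply: affine_form_ge0.
Qed.

Lemma solution_window x y n : solution x y -> (0 < n)%N ->
  nonneg_window k x n%:Z /\ nonneg_window k y n%:Z.
Proof.
move=> /solution_ge0 xy0 n_gt0.
by split=> i ik; [apply: (xy0 _ _).1|apply: (xy0 _ _).2]; lia.
Qed.

(** A denominator at most [S] times the numerator forces the quotient to be at least [S^-1]. *)
Lemma solution_left_bounded_below :
  A = 0 \/ 0 < alpha ->
  {subset index_set k B <= index_set k beta} ->
  {subset index_set k C <= index_set k gamma} ->
  exists2 c : R, 0 < c &
    forall x y, solution x y -> forall n : nat, (0 < n)%N -> c <= x n%:Z.
Proof.
move=> Aa sB sC.
have [S S_gt0 hS] := affine_form_dominated
  alpha_ge0 beta_ge0 gamma_ge0 A_ge0 B_ge0 C_ge0 Aa sB sC.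
exists S^-1 => [|x y sol n n_gt0]; first by rewrite invr_gt0.
have [wx wy] := solution_window sol n_gt0.
case: sol => _ _ /(_ n n_gt0)[den_gt0 _ -> _].
by rewrite ler_pdivlMr // ler_pdivrMl // hS.
Qed.

Lemma solution_right_bounded_below :
  q = 0 \/ 0 < p ->
  {subset index_set k D <= index_set k delta} ->
  {subset index_set k E <= index_set k epsilon} ->
  exists2 c : R, 0 < c &
    forall x y, solution x y -> forall n : nat, (0 < n)%N -> c <= y n%:Z.
Proof.
move=> qp sD sE.
have [S S_gt0 hS] := affine_form_dominated
  p_ge0 delta_ge0 epsilon_ge0 q_ge0 D_ge0 E_ge0 qp sD sE.
exists S^-1 => [|x y sol n n_gt0]; first by rewrite invr_gt0.
have [wx wy] := solution_window sol n_gt0.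
case: sol => _ _ /(_ n n_gt0)[_ den_gt0 _ ->].
by rewrite ler_pdivlMr // ler_pdivrMl // hS.
Qed.

(** The flag [z] selects the pair [x], [B] or the pair [y], [C]. For [n > k] the lagged index is
    positive, beyond the initial values, which may vanish. *)
Lemma denominator_bounded_below (c : R) (i : nat) (z : bool) : 0 < c ->
    i \in index_set k (if z then B else C) ->
    (forall x y, solution x y -> forall n : nat, (0 < n)%N ->
      c <= (if z then x else y) n%:Z) ->
  exists2 d : R, 0 < d &
    forall x y, solution x y -> forall n : nat, (k < n)%N -> d <= den x y n.
Proof.
move=> c_gt0; set b := if z then B else C => /andP[ik /= b_gt0] c_le.
exists (b i * c) => [|x y sol n n_gt]; first exact: mulr_gt0.
have [|wx wy] := @solution_window x y n sol; first by lia.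
have := c_le x y sol (n - i)%N.
rewrite -subzn; last by lia.
move=> hc; apply: (@le_trans _ _ (b i * (if z then x else y) (n%:Z - i%:Z))).
  by apply: ler_wpM2l; [exact: ltW|apply: hc; lia].
rewrite /b; case: (z).
  exact: affine_form_ge_left.
exact: affine_form_ge_right.
Qed.

(** The [gamma] sum is at most [G] times the [C] sum, hence [G] times the denominator, and [alpha]
    is at most [alpha / d] times it; the [beta] sum remains. *)
Lemma solution_step_bound (d : R) :
  0 < d ->
  (forall x y, solution x y -> forall n : nat, (k < n)%N -> d <= den x y n) ->
  {subset index_set k gamma <= index_set k C} ->
  exists2 K : R, 0 <= K & forall x y, solution x y ->
    forall n : nat, (k < n)%N ->
      x n%:Z <= K + (\sum_(1 <= i < k.+1) beta i * x (n%:Z - i%:Z)) / den x y n.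
Proof.
move=> d_gt0 d_le sub.
have [G G_ge0 hG] := wsum_dominated C_ge0 gamma_ge0 sub.
exists (alpha / d + G) => [|x y sol n n_gt].
  by rewrite addr_ge0 // divr_ge0 // ltW.
have [|wx wy] := @solution_window x y n sol; first by lia.
have den_ge := d_le x y sol n n_gt.
have den_gt0 := lt_le_trans d_gt0 den_ge.
have [_ _ /(_ n)[|_ _ -> _]] := sol; first by lia.
rewrite ler_pdivrMr // mulrDl divfK ?gt_eqF // mulrDl.
have ha : alpha <= alpha / d * den x y n.
  by rewrite -mulrA ler_peMr // ler_pdivlMl // mulr1.
have hg := hG _ wy.
have hC : \sum_(1 <= i < k.+1) C i * y (n%:Z - i%:Z) <= den x y n.
  by rewrite lerDr addr_ge0 //; exact: wsum_ge0 B_ge0 wx.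
have := ler_wpM2l G_ge0 hC.
move: hg ha; rewrite [affine_form _ alpha _ _ _ _ _]/affine_form => /=; lra.
Qed.

Lemma left_lag_le_denominator : exists S : R, forall x y, solution x y ->
  forall n j : nat, (k < n)%N -> j \in index_set k B -> (j <= n)%N ->
  x (n - j)%N%:Z <= S * den x y n.
Proof.
(* A bound for all [(B j)^-1] at once; zero coefficients contribute 0, since the inverse of 0 is
   0. *)
exists (\sum_(1 <= i < k.+1) (B i)^-1) => x y sol n j n_gt /andP[jk Bj] jn.
have [|wx wy] := @solution_window x y n sol; first by lia.
have den_ge0 : 0 <= den x y n by exact: affine_form_ge0.
have Binv : (B j)^-1 <= \sum_(1 <= i < k.+1) (B i)^-1.
  rewrite (bigD1_seq j) ?mem_index_iota ?iota_uniq //= lerDl big_seq_cond.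
  apply: sumr_ge0 => i /andP[]; rewrite mem_index_iota => ik _.
  by rewrite invr_ge0 B_ge0.
apply: le_trans (ler_wpM2r den_ge0 Binv).
rewrite -subzn // ler_pdivlMl //; exact: affine_form_ge_left.
Qed.

End Solutions.

Theorem theorem10 (R : realType) (k : nat) (k_gt0 : (0 < k)%N)
    (alpha : R) (beta gamma : nat -> R) (A : R) (B C : nat -> R)
    (p : R) (delta epsilon : nat -> R) (q : R) (D E : nat -> R)
    (alpha_ge0 : 0 <= alpha) (A_ge0 : 0 <= A) (p_ge0 : 0 <= p) (q_ge0 : 0 <= q)
    (beta_ge0 : nonneg_coefs k beta) (gamma_ge0 : nonneg_coefs k gamma)
    (B_ge0 : nonneg_coefs k B) (C_ge0 : nonneg_coefs k C)
    (delta_ge0 : nonneg_coefs k delta) (epsilon_ge0 : nonneg_coefs k epsilon)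
    (D_ge0 : nonneg_coefs k D) (E_ge0 : nonneg_coefs k E)
    (A_eq0 : A = 0)
    (cond :
      [\/ [/\ {subset index_set k B <= index_set k beta},
              {subset index_set k C <= index_set k gamma} &
              exists i : nat, i \in index_set k B],
          [/\ q = 0,
              {subset index_set k D <= index_set k delta},
              {subset index_set k E <= index_set k epsilon} &
              exists i : nat, i \in index_set k C] |
          [/\ 0 < p, 0 < q,
              {subset index_set k D <= index_set k delta},
              {subset index_set k E <= index_set k epsilon} &
              exists i : nat, i \in index_set k C]])
    (gamma_C : {subset index_set k gamma <= index_set k C})
    (chain : exists eta : nat, (0 < eta)%N /\
      forall c : nat -> nat,
        (forall m : nat, (1 <= m)%N -> c m \in index_set k beta) ->
        exists N1 N2 : nat,
          [/\ (1 <= N1 <= eta)%N, (1 <= N2 <= eta)%N &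
              (\sum_(N1 <= m < N2.+1) c m)%N \in index_set k B]) :
  exists (M : R) (N : nat), [/\ 0 < M, (0 < N)%N &
    forall x y : int -> R,
      is_solution k alpha beta gamma A B C p delta epsilon q D E x y ->
      forall n : nat, (N < n)%N -> x n%:Z <= M].

Proof.
(* Cases (ii) and (iii) merge: both give [q = 0 \/ 0 < p], which lets the numerator of [y] dominate
   the constant [q]. *)
have {cond} cond :
    [/\ {subset index_set k B <= index_set k beta},
        {subset index_set k C <= index_set k gamma} &
        exists i : nat, i \in index_set k B] \/
    [/\ q = 0 \/ 0 < p, {subset index_set k D <= index_set k delta},
        {subset index_set k E <= index_set k epsilon} &
        exists i : nat, i \in index_set k C].
  by case: cond => [|[]|[]]; [left|right; split; auto|right; split; auto].
have [d d_gt0 d_le] : exists2 d : R, 0 < d & forall x y,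
    is_solution k alpha beta gamma A B C p delta epsilon q D E x y ->
    forall n : nat, (k < n)%N -> d <= affine_form k A B C x y n%:Z.
  case: cond => [[sB sC [i iB]]|[qp sD sE [i iC]]].
    have [c c_gt0 hc] := solution_left_bounded_below D E alpha_ge0 A_ge0 p_ge0
      q_ge0 beta_ge0 gamma_ge0 B_ge0 C_ge0 delta_ge0 epsilon_ge0
      (or_introl A_eq0) sB sC.
    exact: (denominator_bounded_below (z := true) _ _ _ _ _ _ _ _ _ _
      c_gt0 iB hc).
  have [c c_gt0 hc] := solution_right_bounded_below B C alpha_ge0 A_ge0 p_ge0
    q_ge0 beta_ge0 gamma_ge0 delta_ge0 epsilon_ge0 D_ge0 E_ge0 qp sD sE.
  exact: (denominator_bounded_below (z := false) _ _ _ _ _ _ _ _ _ _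
    c_gt0 iC hc).
have [K K_ge0 hK] := solution_step_bound alpha_ge0 A_ge0 p_ge0 q_ge0 beta_ge0
  gamma_ge0 B_ge0 C_ge0 delta_ge0 epsilon_ge0 d_gt0 d_le gamma_C.
have [S hS] := left_lag_le_denominator D E alpha_ge0 A_ge0 p_ge0 q_ge0
  beta_ge0 gamma_ge0 B_ge0 C_ge0 delta_ge0 epsilon_ge0.
have [eta [eta_gt0 chainP]] := chain.
pose L := \sum_(1 <= i < k.+1) beta i.
have L_ge0 : 0 <= L by rewrite /L big_nat; exact: sumr_ge0.
(* This covers both [K], the bound when no [beta] is positive, and the chain bound. *)
exists (1 + K + `|chain_bound eta K L d S|), (eta.+1 * k)%N.
split=> [||x y sol n n_gt]; [by rewrite ltr_pwDl ?addr_ge0 // ltr_pwDl | lia |].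
have x_ge0 (m : nat) : 0 <= x m%:Z.
  by apply: (solution_ge0 _ _ _ _ _ _ _ _ sol _).1 => //; lia.
have k_lt m : (eta.+1 * k < m)%N -> (k < m)%N by nia.
(* Without a positive [beta] there is no lag to follow, but then the [beta] sum is 0. *)
have [/hasP[i0 _ i0b]|/hasPn no_beta] :=
  boolP (has [in index_set k beta] (iota 0 k.+1)); last first.
  have sum0 : \sum_(1 <= i < k.+1) beta i * x (n%:Z - i%:Z) = 0.
    rewrite big_nat big1 // => i ik.
    rewrite (notin_index_set beta_ge0 ik) ?mul0r //.
    by apply: no_beta; rewrite mem_iota; lia.
  have := hK x y sol n (k_lt n n_gt); rewrite sum0 mul0r addr0.
  have := normr_ge0 (chain_bound eta K L d S); lra.
suff : x n%:Z <= chain_bound eta K L d S.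
  have := ler_norm (chain_bound eta K L d S); lra.
apply: (@chain_bound_le R k eta (index_set k beta) (index_set k B)
  (fun m => x m%:Z) (fun m => affine_form k A B C x y m%:Z)) => //.
- by move=> i; rewrite inE => /andP[/andP[]].
- by move=> i; rewrite inE => /andP[/andP[]].
- exact: d_le.
- by move=> m j m_gt jB jm; exact: hS.
move=> m.
have [i /andP[ib le_i]] := wsum_le_argmax beta_ge0 i0b
  (fun i => x (m%:Z - i%:Z)).
exists i; rewrite ib /=; apply/implyP => m_gt.
apply: (le_trans (hK x y sol m m_gt)); rewrite lerD2l mulrA.
have i_le : (i <= m)%N by move: ib; rewrite inE => /andP[/andP[]]; lia.
rewrite -subzn //; apply: ler_wpM2r => //.
by rewrite invr_ge0; apply/ltW/(lt_le_trans d_gt0)/d_le.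
Qed.
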